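(* Let $\mathcal{H}=\mathcal{H}(\Omega)$ be a functional (reproducing kernel) Hilbert space on a nonempty set $\Omega$, let $t\in[0,1]$ and let $A\in\mathcal{B}(\mathcal{H})$. Then $$\|A\|_{t-ber}\le\sqrt{\|tA^*A+(1-t)AA^*\|_{ber}}.$$ Moreover, for $t=\frac12$, $$\|A\|_{\frac12-ber}\le\sqrt{\tfrac12\|A^*A+AA^*\|_{ber}}.$$
   Context: A functional (reproducing kernel) Hilbert space $\mathcal{H}=\mathcal{H}(\Omega)$ is a Hilbert space of complex-valued functions on a nonempty set $\Omega$ such that for every $\lambda\in\Omega$ the evaluation $f\mapsto f(\lambda)$ is a continuous linear functional; $k_\lambda\in\mathcal{H}$ is the unique element with $f(\lambda)=\langle f,k_\lambda\rangle$ for all $f\in\mathcal{H}$. It is assumed that $k_\lambda\neq0$ for all $\lambda\in\Omega$, and $\hat{k}_\lambda=k_\lambda/\|k_\lambda\|$ is the normalized reproducing kernel. $\mathcal{B}(\mathcal{H})$ is the algebra of bounded linear operators on $\mathcal{H}$. For $A\in\mathcal{B}(\mathcal{H})$ and $t\in[0,1]$, $$\|A\|_{t-ber}=\sup_{\lambda,\mu\in\Omega}\left\{t|\langle A\hat{k}_\lambda,\hat{k}_\mu\rangle|+(1-t)|\langle A^*\hat{k}_\lambda,\hat{k}_\mu\rangle|\right\},\qquad \|A\|_{ber}=\sup_{\lambda,\mu\in\Omega}|\langle A\hat{k}_\lambda,\hat{k}_\mu\rangle|.$$ *)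

(* Defs.v *)
From HB Require Import structures.
From mathcomp Require Import all_boot all_order all_algebra sesquilinear.
From mathcomp Require Import all_classical reals topology normedtype complex.
From mathcomp Require Import ring lra.
Set Implicit Arguments.
Unset Strict Implicit.
Unset Printing Implicit Defensive.
Import Order.TTheory GRing.Theory Num.Theory numFieldNormedType.Exports.
Import ComplexField.Normc.
Local Open Scope classical_set_scope.
Local Open Scope complex_scope.
Local Open Scope ring_scope.

(* The inner product of type {dot H for Num.conj} is positive definite, linear
   in its first argument and conjugate-linear in the second. *)
HB.mixin Record NormedModule_isHilbert (R : realType) H
    of CompleteNormedModule R[i] H := {
  inner : {dot H for Num.conj};
  inner_norm : forall x : H, inner x x = `|x| ^+ 2
}.

#[short(type="hilbertType")]
HB.structure Definition Hilbert (R : realType) :=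
  {H of CompleteNormedModule R[i] H & NormedModule_isHilbert R H}.

(* H is a Hilbert space of complex-valued functions on Omega: the injective
   linear map feval identifies an element of H with a function on Omega, so
   that feval f l stands for f(l). *)
HB.mixin Record Hilbert_isFunctional (R : realType) (Omega : Type) H
    of Hilbert R H := {
  feval : {linear H -> (Omega -> R[i]^o)};
  feval_inj : injective feval;
  feval_continuous : forall l : Omega, continuous (fun f : H => feval f l)
}.

#[short(type="rkhsType")]
HB.structure Definition RKHS (R : realType) (Omega : Type) :=
  {H of Hilbert R H & Hilbert_isFunctional R Omega H}.

Section Hilbert.
Variables (R : realType) (H : hilbertType R).
Implicit Types x y z : H.
Local Notation C := (R[i]).

Local Definition nr x : R := complex.Re `|x|.

Local Lemma nrE x : `|x| = (nr x)%:C.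
Proof.
rewrite /nr; have := normr_ge0 x; case: (`|x|) => a b.
by rewrite lecE /= => /andP[/eqP -> _].
Qed.

Local Lemma nr_ge0 x : 0 <= nr x.
Proof. by rewrite -ler0c -nrE. Qed.

Local Lemma innerxx x : inner x x = (nr x ^+ 2)%:C.
Proof. by rewrite inner_norm nrE rmorphXn. Qed.

Lemma innerC x y : inner x y = (inner y x)^*.
Proof. by rewrite hermC expr0 mul1r. Qed.

Lemma inner_ext y z : (forall x, inner x y = inner x z) -> y = z.
Proof.
move=> h; apply/eqP; rewrite -subr_eq0 -(dnorm_eq0 (@inner R H)).
by rewrite linearBr /= h subrr.
Qed.

Local Lemma nr2B x y :
  nr (x - y) ^+ 2 = nr x ^+ 2 + nr y ^+ 2 - complex.Re (inner x y) *+ 2.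
Proof.
apply: complexI; rewrite -innerxx dnormB !innerxx.
case: (inner x y) => a b; apply/eqP; rewrite eq_complex /=.
by apply/andP; split; apply/eqP; ring.
Qed.

Local Lemma nr2D x y :
  nr (x + y) ^+ 2 = nr x ^+ 2 + nr y ^+ 2 + complex.Re (inner x y) *+ 2.
Proof.
apply: complexI; rewrite -innerxx dnormD !innerxx.
case: (inner x y) => a b; apply/eqP; rewrite eq_complex /=.
by apply/andP; split; apply/eqP; ring.
Qed.

Local Lemma nrZ (a : R) x : nr (a%:C *: x) = `|a| * nr x.
Proof.
apply: complexI; rewrite -nrE normrZ nrE rmorphM; congr (_ * _).
by rewrite normc_def /= expr0n addr0 sqrtr_sqr.
Qed.


Local Lemma normcE (z : C) : `|z| = (normc z)%:C.
Proof. by case: z. Qed.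

Local Lemma nr2BZ (s : R) x y : 0 <= s ->
  nr (x - (s%:C * inner x y) *: y) ^+ 2 =
  nr x ^+ 2 - 2 * s * normc (inner x y) ^+ 2
  + (s * normc (inner x y) * nr y) ^+ 2.
Proof.
move=> s0; rewrite nr2B linearZr_LR /=; set c := inner x y.
have -> : nr ((s%:C * c) *: y) = s * normc c * nr y.
  apply: complexI; rewrite -nrE normrZ nrE !rmorphM normrM.
  by congr (_ * _ * _); rewrite normc_def /= expr0n addr0 sqrtr_sqr ger0_norm.
have -> : complex.Re ((s%:C * c)^* * c) = s * normc c ^+ 2.
  by case: (c) => a b /=; rewrite sqr_sqrtr ?addr_ge0 ?sqr_ge0//; ring.
by rewrite -mulr_natl; ring.
Qed.

Lemma inner_le_norm x y : `|inner x y| <= `|x| * `|y|.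
Proof.
have [->|y0] := eqVneq y 0; first by rewrite linear0r !normr0 mulr0.
have ny0 : 0 < nr y by rewrite -ltcR -nrE normr_gt0.
rewrite normcE !nrE -rmorphM lecR.
rewrite -(@ler_pXn2r _ 2) ?nnegrE ?mulr_ge0 ?nr_ge0//; last first.
  by rewrite -ler0c -normcE.
set c := normc _; have s0 : 0 <= (nr y ^+ 2)^-1 by rewrite invr_ge0 sqr_ge0.
have := sqr_ge0 (nr (x - ((nr y ^+ 2)^-1%:C * inner x y) *: y)).
rewrite nr2BZ// -/c => h.
have {h} : 0 <= (nr x ^+ 2 - c ^+ 2 / nr y ^+ 2).
  apply: (le_trans h); rewrite le_eqVlt; apply/orP; left; apply/eqP.
  by field; rewrite gt_eqF.
by rewrite subr_ge0 ler_pdivrMr ?exprn_gt0// exprMn.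
Qed.

Section Riesz.
Variable phi : H -> C.
Hypothesis phi_lin : scalar phi.
Hypothesis phi_bounded : exists M : R, forall x, `|phi x| <= M%:C * `|x|.

Let phiD x y : phi (x + y) = phi x + phi y.
Proof. by have := phi_lin 1 x y; rewrite scale1r mul1r. Qed.

Let phi0 : phi 0 = 0.
Proof. by apply: (addrI (phi 0)); rewrite -phiD !addr0. Qed.

Let phiZ a x : phi (a *: x) = a * phi x.
Proof. by have := phi_lin a x 0; rewrite !addr0 phi0 addr0. Qed.

Let phiB x y : phi (x - y) = phi x - phi y.
Proof. by rewrite phiD -scaleN1r phiZ mulN1r. Qed.

Let S := [set x | phi x = 1].
Let d := inf [set nr x ^+ 2 | x in S].

Hypothesis S0 : S !=set0.

Let dlb x : S x -> d <= nr x ^+ 2.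
Proof.
move=> Sx; apply: ge_inf; last by exists x.
by exists 0 => _ [y _ <-]; rewrite sqr_ge0.
Qed.

Let Se (e : R) := [set x | S x /\ nr x ^+ 2 < d + e].

Let Se0 e : 0 < e -> Se e !=set0.
Proof.
move=> e0; have hi : has_inf [set nr x ^+ 2 | x in S].
  split; first by case: S0 => x Sx; exists (nr x ^+ 2), x.
  by exists 0 => _ [y _ <-]; rewrite sqr_ge0.
by have [_ [x Sx <-] xlt] := inf_adherent e0 hi; exists x.
Qed.

Let F := filter_from [set e : R | 0 < e] Se.

Let FF : ProperFilter F.
Proof.
apply: filter_from_proper => [|e]; last exact: Se0.
apply: filter_from_filter; first by exists 1 => /=.
move=> e1 e2 e10 e20; exists (Num.min e1 e2); first by rewrite /= lt_min e10.
move=> x [Sx]; rewrite addr_minr lt_min => /andP[h1 h2].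
by split.
Qed.

Let Fclose e x y : Se e x -> Se e y -> nr (x - y) ^+ 2 < 4 * e.
Proof.
move=> [Sx xe] [Sy ye].
have Sm : S ((1 / 2 : R)%:C *: (x + y)).
  rewrite /S /= phiZ phiD Sx Sy; apply/eqP; rewrite eq_complex /=.
  by apply/andP; split; apply/eqP; field.
have := dlb Sm; rewrite nrZ exprMn (nr2D x y) ger0_norm ?divr_ge0//.
by rewrite nr2B; lra.
Qed.

Let Fcauchy : cauchy F.
Proof.
have ? : ProperFilter F := FF.
apply/cauchyP => -[e e'] /[dup]; rewrite {1}ltcE /= => /andP[/eqP -> e0 _].
have e40 : 0 < e ^+ 2 / 4 by rewrite divr_gt0 ?exprn_gt0.
have [x Sx] := Se0 e40.
exists x; exists (e ^+ 2 / 4) => // y Sy /=.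
rewrite -ball_normE /ball_ /= nrE complexr0 ltcR.
have := Fclose Sx Sy; have -> : 4 * (e ^+ 2 / 4) = e ^+ 2 by field.
by rewrite ltr_pXn2r// nnegrE ?nr_ge0// ltW.
Qed.

Local Lemma riesz_proper : exists k, forall x, phi x = inner x k.
Proof.
have ? : ProperFilter F := FF.
pose p : H := lim F; have Fp : F --> p by exact: (@cauchy_cvg H F FF Fcauchy).
have near (e eta : R) : 0 < e -> 0 < eta ->
    exists2 x, Se e x & nr (p - x) < eta.
  move=> e0 eta0; have etaC : (0 : C) < eta%:C by rewrite ltcR.
  have h : F (ball p eta%:C) by exact: (Fp _ (nbhsx_ballx p _ etaC)).
  have h2 : F (Se e) by exists e.
  have [x [/= h1 Sx]] := filter_ex (filterI h h2).
  by exists x => //; move: h1; rewrite -ball_normE /ball_ /= nrE ltcR.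
have d0 : 0 <= d.
  apply: lb_le_inf; first by case: S0 => x Sx; exists (nr x ^+ 2), x.
  by move=> _ [y _ <-]; rewrite sqr_ge0.
have Sp : phi p = 1.
  have [M hM] := phi_bounded.
  apply/eqP; rewrite -subr_eq0 -normr_eq0 eq_le normr_ge0 andbT.
  rewrite normcE lecR leNgt; apply/negP; set r := normc _ => r0.
  have N0 : 0 < `|M| + 1 by rewrite ltr_wpDl.
  have [x [Sx _] px] := near 1 (r / (`|M| + 1)) ltr01 (divr_gt0 r0 N0).
  have := hM (p - x); rewrite phiB Sx.
  rewrite normcE nrE -rmorphM lecR -/r leNgt => /negP; apply.
  rewrite (@le_lt_trans _ _ ((`|M| + 1) * nr (p - x)))//.
    by rewrite ler_wpM2r ?nr_ge0// (le_trans (ler_norm _))// lerDl.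
  by rewrite mulrC -ltr_pdivlMr.
have pd : nr p ^+ 2 <= d.
  apply/ler_addgt0Pr => e e0.
  have e20 : 0 < e / 2 by rewrite divr_gt0.
  pose K := d + e + 1.
  have K0 : 0 < 2 * K + 1 by rewrite /K; lra.
  pose eta := Num.min 1 (e / 2 / (2 * K + 1)).
  have eta0 : 0 < eta by rewrite lt_min ltr01 divr_gt0.
  have [x [_ xe] px] := near (e / 2) eta e20 eta0.
  have eta1 : eta <= 1 by rewrite /eta ge_min lexx.
  have etaK : eta * (2 * K + 1) <= e / 2.
    by rewrite -ler_pdivlMr// /eta ge_min lexx orbT.
  have xK : nr x <= K.
    have := nr_ge0 x; rewrite /K => x0.
    have [x1|/ltW x1] := leP (nr x) 1; first lra.
    by have : nr x <= nr x ^+ 2 by [rewrite expr2 ler_peMl]; lra.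
  have tri : nr p <= nr x + nr (p - x).
    rewrite -lecR rmorphD /= -!nrE -{1}(subrKC x p).
    exact: ler_normD.
  have : nr p ^+ 2 <= (nr x + eta) ^+ 2.
    by rewrite lerXn2r ?nnegrE ?nr_ge0 ?addr_ge0 ?nr_ge0 ?(ltW eta0)//; lra.
  have : nr x * eta <= K * eta by rewrite ler_wpM2r// ltW.
  have : eta * eta <= eta by rewrite ler_piMr// ltW.
  by rewrite sqrrD -mulr_natl; nra.
have ort h : phi h = 0 -> inner p h = 0.
  move=> h0; set c := inner p h.
  have key (s : R) : 0 <= s ->
      2 * normc c ^+ 2 * s <= s ^+ 2 * normc c ^+ 2 * nr h ^+ 2.
    move=> s0; have Sq : S (p - (s%:C * c) *: h).
      by rewrite /S /= phiB phiZ h0 mulr0 subr0.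
    by have := le_trans pd (dlb Sq); rewrite nr2BZ// -/c !exprMn; lra.
  have q0 : 0 < nr h ^+ 2 + 1 by rewrite ltr_wpDl ?sqr_ge0.
  have s0 : 0 <= (nr h ^+ 2 + 1)^-1 by rewrite invr_ge0 ltW.
  have := key _ s0.
  have : (nr h ^+ 2 + 1)^-1 * (nr h ^+ 2 + 1) = 1 by rewrite mulVf ?gt_eqF.
  set s := _^-1; set a := nr h ^+ 2; set b := normc c ^+ 2 => sE hb.
  have b0 : 0 <= b by rewrite sqr_ge0.
  have sp : 0 < s by rewrite invr_gt0.
  have : b <= 0.
    have : 2 * b <= s * b * a.
      rewrite -(ler_pM2r sp).
      by have <- : s ^+ 2 * b * a = s * b * a * s by [ring].
    have -> : s * b * a = b * (s * (a + 1)) - s * b by ring.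
    rewrite sE; have := mulr_ge0 (ltW sp) b0; lra.
  move=> b1; apply: eq0_normc; apply/eqP; rewrite -sqrf_eq0 -/b.
  by rewrite eq_le b1.
have p0 : nr p ^+ 2 != 0.
  rewrite sqrf_eq0; apply/eqP => /(congr1 (real_complex R)).
  rewrite -nrE => /normr0_eq0 p0; move: Sp; rewrite p0 phi0 => /eqP.
  by rewrite eq_sym oner_eq0.
exists ((nr p ^- 2)%:C *: p) => x.
have h0 : phi (x - phi x *: p) = 0 by rewrite phiB phiZ Sp mulr1 subrr.
have := ort _ h0; rewrite innerC linearBl /= linearZl_LR /= innerxx.
move=> /(congr1 (@Num.conj _)); rewrite conjCK conjC0 => /subr0_eq xp.
have cr : Num.conj (nr p ^- 2)%:C = (nr p ^- 2)%:C by exact: conjc_real.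
rewrite linearZr_LR /= cr xp mulrCA -rmorphM mulVf ?rmorph1 ?mulr1//.
Qed.
End Riesz.

Theorem riesz (phi : H -> C) : scalar phi ->
    (exists M : R, forall x, `|phi x| <= M%:C * `|x|) ->
  exists k, forall x, phi x = inner x k.
Proof.
move=> phi_lin phi_bounded.
have [[x px]|phi0] := pselect (exists x, phi x != 0).
  apply: riesz_proper => //; exists ((phi x)^-1 *: x) => /=.
  have p0 : phi 0 = 0.
    apply: (addrI (phi 0)); have := phi_lin 1 0 0.
    by rewrite scale1r mul1r !addr0 => /esym.
  by have := phi_lin (phi x)^-1 x 0; rewrite !addr0 p0 addr0 mulVf.
exists 0 => x; rewrite linear0r; apply/eqP/negP => /negP px.
by apply: phi0; exists x.
Qed.
End Hilbert.


Definition bounded_operator (R : realType) (H : hilbertType R) (A : H -> H) :=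
  linear A /\ exists M : R, forall x, `|A x| <= M%:C * `|x|.

(* The default value 0 of xget is not used when A is bounded (adjointP), and by
   inner_ext the element chosen is unique; likewise for rkernel below. *)
Definition adjoint (R : realType) (H : hilbertType R) (A : H -> H)
    (y : H) : H :=
  xget 0 [set z | forall x, inner (A x) y = inner x z].

Lemma adjointP (R : realType) (H : hilbertType R) (A : H -> H) :
  bounded_operator A -> forall x y, inner (A x) y = inner x (adjoint A y).
Proof.
move=> [Alin [M AM]] x y; rewrite /adjoint; case: xgetP => [z _ /= ->//|h].
have [||z hz] := @riesz R H (fun x => inner (A x) y); last by case: (h z).
  by move=> a u v; rewrite Alin linearDl /= linearZl_LR.
have yR : `|y| = (complex.Re `|y|)%:C by rewrite [LHS]nrE.
exists (M * complex.Re `|y|) => u; rewrite (le_trans (inner_le_norm _ _))//.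
by rewrite rmorphM /= -yR mulrAC ler_wpM2r.
Qed.

Definition rkernel (R : realType) (Omega : Type) (H : rkhsType R Omega)
    (l : Omega) : H :=
  xget 0 [set k | forall f : H, feval f l = inner f k].

Lemma rkernelP (R : realType) (Omega : Type) (H : rkhsType R Omega)
    (l : Omega) (f : H) : feval f l = inner f (rkernel H l).
Proof.
rewrite /rkernel; case: xgetP => [k _ /= ->//|h].
have lin : linear (fun f : H => feval f l : R[i]^o).
  by move=> a u v; rewrite linearP.
pose phi : {linear H -> R[i]^o} := HB.pack (fun f : H => feval f l : R[i]^o)
  (GRing.isLinear.Build R[i] H R[i]^o *:%R _ lin).
have [||k hk] := @riesz R H (fun f : H => feval f l); last by case: (h k).
  by move=> a u v; rewrite linearP.
have /linear_boundedP : bounded_near phi (nbhs 0).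
  by apply/linear_bounded_continuous; exact: feval_continuous.
move=> /pinfty_ex_gt0 [M M0 hM].
exists (complex.Re M) => u; move: M0 (hM u); case: M {hM} => a b.
by rewrite ltcE /= => /andP[/eqP -> _].
Qed.

Definition nkernel (R : realType) (Omega : Type) (H : rkhsType R Omega)
    (l : Omega) : H :=
  `|rkernel H l|^-1 *: rkernel H l.

(* normc z : R is the modulus of z : R[i], whereas `|z| is an element of R[i].
   Both suprema are of nonempty sets of reals, bounded above when A is a bounded
   operator. *)
Definition tber_norm (R : realType) (Omega : Type) (H : rkhsType R Omega)
    (t : R) (A : H -> H) : R :=
  sup [set t * normc (inner (A (nkernel H p.1)) (nkernel H p.2))
       + (1 - t) * normc (inner (adjoint A (nkernel H p.1)) (nkernel H p.2))
      | p in [set: Omega * Omega]].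

Definition ber_norm (R : realType) (Omega : Type) (H : rkhsType R Omega)
    (A : H -> H) : R :=
  sup [set normc (inner (A (nkernel H p.1)) (nkernel H p.2))
      | p in [set: Omega * Omega]].

(* Main.v *)
Require Import Defs.
From mathcomp Require Import all_boot all_order all_algebra.
From mathcomp Require Import all_classical reals topology normedtype complex.
From mathcomp Require Import sesquilinear ring lra.
Import Order.TTheory GRing.Theory Num.Theory.
Import ComplexField.Normc.
Local Open Scope classical_set_scope.
Local Open Scope complex_scope.
Local Open Scope ring_scope.

(** Let [x] and [y] be normalized reproducing kernels, hence unit vectors.
    Cauchy-Schwarz bounds [t |<A x, y>| + (1 - t) |<A^* x, y>|] by the convex
    combination [t |A x| + (1 - t) |A^* x|], whose square is, by convexity of
    the square, at most [t |A x|^2 + (1 - t) |A^* x|^2]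
    ([tber_norm_le_sqrt]).  The latter number is the diagonal Berezin value
    [<(t A^* A + (1 - t) A A^* ) x, x>] ([inner_adjoint_mul],
    [inner_mul_adjoint]), so it is at most the Berezin norm of that operator
    ([normc_inner_le_ber_norm]).  The case [t = 1 / 2] is obtained in the same
    way from [<(A^* A + A A^* ) x, x>].  Since a supremum of reals is an upper
    bound only of a bounded set, the operators involved must be shown bounded;
    this reduces to the boundedness of the adjoint ([adjoint_norm_le]). *)

Section HilbertNorm.
Context {R : realType} {H : hilbertType R}.
Implicit Types (x y : H) (A T : H -> H).

(** The norm of [H] takes its values in [R[i]]; [rnorm] is the same norm with
    values in [R]. *)
Definition rnorm x : R := complex.Re `|x|.

Lemma rnormE x : `|x| = (rnorm x)%:C.
Proof. exact: Defs.nrE. Qed.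

Lemma rnorm_ge0 x : 0 <= rnorm x.
Proof. exact: Defs.nr_ge0. Qed.

Lemma inner_self x : inner x x = (rnorm x ^+ 2)%:C.
Proof. exact: Defs.innerxx. Qed.

Lemma normc_inner_le x y : normc (inner x y) <= rnorm x * rnorm y.
Proof. by have := inner_le_norm x y; rewrite Defs.normcE !rnormE -rmorphM lecR. Qed.

Lemma rnormD_le x y : rnorm (x + y) <= rnorm x + rnorm y.
Proof. by have := ler_normD x y; rewrite !rnormE -rmorphD lecR. Qed.

Lemma rnormZ (a : R) x : rnorm (a%:C *: x) = `|a| * rnorm x.
Proof. exact: Defs.nrZ. Qed.

(** [T] satisfies a norm bound but need not be linear; the bound alone makes
    the supremum defining the Berezin norm of [T] finite. *)
Definition norm_bounded T := exists M : R, forall x, rnorm (T x) <= M * rnorm x.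

Lemma bounded_operator_norm_bounded {A} : bounded_operator A -> norm_bounded A.
Proof.
move=> [_ [M AM]]; exists M => x.
by have := AM x; rewrite !rnormE -rmorphM lecR.
Qed.

(** From [|A^* y|^2 = <A A^* y, y> <= M |A^* y| |y|]. *)
Lemma adjoint_norm_le {A} {M : R} : bounded_operator A ->
  (forall x, rnorm (A x) <= M * rnorm x) ->
  forall y, rnorm (adjoint A y) <= M * rnorm y.
Proof.
move=> Ab AM y; set z := adjoint A y.
have [z0|z0] := eqVneq (rnorm z) 0.
  (* [M] may be negative, but only if the norm vanishes on [H] *)
  by rewrite z0; apply: le_trans (AM y); exact: rnorm_ge0.
have zp : 0 < rnorm z by rewrite lt_neqAle eq_sym z0 rnorm_ge0.
rewrite -(ler_pM2l zp) -expr2.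
have -> : rnorm z ^+ 2 = normc (inner (A z) y).
  rewrite adjointP// -/z inner_self /normc /= expr0n addr0 sqrtr_sqr.
  by rewrite ger0_norm// sqr_ge0.
apply: le_trans (normc_inner_le _ _) _.
by rewrite mulrCA mulrA ler_wpM2r ?rnorm_ge0.
Qed.

Lemma adjoint_norm_bounded {A} : bounded_operator A -> norm_bounded (adjoint A).
Proof.
move=> Ab; have [M AM] := bounded_operator_norm_bounded Ab.
by exists M; exact: adjoint_norm_le.
Qed.

Lemma norm_bounded_comp {S T : H -> H} :
  norm_bounded S -> norm_bounded T -> norm_bounded (S \o T).
Proof.
move=> [M SM] [N TN]; exists (`|M| * N) => x /=.
apply: le_trans (SM _) _.
apply: (@le_trans _ _ (`|M| * rnorm (T x))).
  by rewrite ler_wpM2r ?rnorm_ge0 ?ler_norm.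
by rewrite -mulrA ler_wpM2l.
Qed.

Lemma norm_boundedD {S T : H -> H} :
  norm_bounded S -> norm_bounded T -> norm_bounded (S \+ T).
Proof.
move=> [M SM] [N TN]; exists (M + N) => x /=.
by apply: le_trans (rnormD_le _ _) _; rewrite mulrDl lerD.
Qed.

Lemma norm_boundedZ (a : R) {T} : norm_bounded T -> norm_bounded (a%:C \*: T).
Proof.
move=> [M TM]; exists (`|a| * M) => x /=.
by rewrite rnormZ -mulrA ler_wpM2l.
Qed.

Lemma inner_adjoint_mul {A} x : bounded_operator A ->
  inner (adjoint A (A x)) x = (rnorm (A x) ^+ 2)%:C.
Proof.
by move=> Ab; rewrite innerC -adjointP// inner_self; exact: conjc_real.
Qed.

Lemma inner_mul_adjoint {A} x : bounded_operator A ->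
  inner (A (adjoint A x)) x = (rnorm (adjoint A x) ^+ 2)%:C.
Proof. by move=> Ab; rewrite adjointP// inner_self. Qed.

End HilbertNorm.

Section Berezin.
Context {R : realType} {Omega : Type} {H : rkhsType R Omega}.
Context (rkernel_neq0 : forall l : Omega, rkernel H l != 0).
Implicit Types (A T : H -> H) (l m : Omega).

Lemma rnorm_nkernel l : rnorm (nkernel H l) = 1.
Proof.
apply: complexI; rewrite -rnormE /nkernel normrZ normfV normr_id mulVf//.
by rewrite normr_eq0.
Qed.

Lemma normc_inner_nkernel_le (x : H) m :
  normc (inner x (nkernel H m)) <= rnorm x.
Proof. by have := normc_inner_le x (nkernel H m); rewrite rnorm_nkernel mulr1. Qed.

Lemma normc_inner_le_ber_norm {T} l m : norm_bounded T ->
  normc (inner (T (nkernel H l)) (nkernel H m)) <= ber_norm T.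
Proof.
move=> [M TM]; apply: ub_le_sup; last by exists (l, m).
exists M => _ [[l' m'] _ <-] /=; apply: le_trans (normc_inner_nkernel_le _ _) _.
by have := TM (nkernel H l'); rewrite rnorm_nkernel mulr1.
Qed.

Lemma le_ber_norm_of_diag {T l} {r : R} : norm_bounded T ->
  inner (T (nkernel H l)) (nkernel H l) = r%:C -> r <= ber_norm T.
Proof.
move=> Tb Tr; apply: le_trans (normc_inner_le_ber_norm l l Tb).
by rewrite Tr /normc /= expr0n addr0 sqrtr_sqr ler_norm.
Qed.

Lemma tber_norm_le_sqrt {A} {t B : R} : [set: Omega] !=set0 -> 0 <= t <= 1 ->
  (forall l, t * rnorm (A (nkernel H l)) ^+ 2 +
     (1 - t) * rnorm (adjoint A (nkernel H l)) ^+ 2 <= B) ->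
  tber_norm t A <= Num.sqrt B.
Proof.
move=> [l0 _] /andP[t0 t1] AB; apply: ge_sup.
  by eexists; exists (l0, l0).
move=> _ [[l m] _ <-] /=.
have := AB l; set a := rnorm (A _); set b := rnorm (adjoint A _) => abB.
have t1' : 0 <= 1 - t by rewrite subr_ge0.
apply: (@le_trans _ _ (t * a + (1 - t) * b)).
  by rewrite lerD// ler_wpM2l// normc_inner_nkernel_le.
have s0 : 0 <= t * a + (1 - t) * b.
  by rewrite addr_ge0// mulr_ge0// rnorm_ge0.
rewrite -(ger0_norm s0) -sqrtr_sqr; apply: ler_wsqrtr; apply: le_trans abB.
rewrite -subr_ge0.
have -> : t * a ^+ 2 + (1 - t) * b ^+ 2 - (t * a + (1 - t) * b) ^+ 2 =
          t * (1 - t) * (a - b) ^+ 2 by ring.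
by rewrite mulr_ge0 ?sqr_ge0 ?mulr_ge0.
Qed.

End Berezin.

Theorem theorem2p6 (R : realType) (Omega : Type) (H : rkhsType R Omega)
    (Omega_neq0 : [set: Omega] !=set0)
    (rkernel_neq0 : forall l : Omega, rkernel H l != 0)
    (A : H -> H) (A_bounded : bounded_operator A) :
  (forall t : R, 0 <= t <= 1 ->
    tber_norm t A <=
      Num.sqrt (ber_norm (t%:C \*: (adjoint A \o A)
                          \+ (1 - t)%:C \*: (A \o adjoint A)))) /\
  tber_norm (1 / 2) A <=
    Num.sqrt (1 / 2 * ber_norm ((adjoint A \o A) \+ (A \o adjoint A))).
Proof.
have Ab := bounded_operator_norm_bounded A_bounded.
have A'b := adjoint_norm_bounded A_bounded.
have A'Ab := norm_bounded_comp A'b Ab.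
have AA'b := norm_bounded_comp Ab A'b.
split=> [t t01|].
  apply: tber_norm_le_sqrt => // l.
  apply: (le_ber_norm_of_diag rkernel_neq0 (l := l)).
    by apply: norm_boundedD; exact: norm_boundedZ.
  rewrite /= linearDl /= !linearZl_LR /= inner_adjoint_mul// inner_mul_adjoint//.
  by rewrite [RHS]rmorphD [in RHS]rmorphM [X in _ = _ + X]rmorphM.
apply: tber_norm_le_sqrt => // [|l]; first by lra.
have -> : 1 - 1 / 2 = 1 / 2 :> R by field.
rewrite -mulrDr ler_wpM2l ?divr_ge0//.
apply: (le_ber_norm_of_diag rkernel_neq0 (l := l)).
  exact: norm_boundedD.
by rewrite /= linearDl /= inner_adjoint_mul// inner_mul_adjoint// rmorphD.
Qed.
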